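(* Let $\mathcal{H}$ be a real Hilbert space, $Q\subset\mathcal{H}$ a nonempty, closed and convex subset, $S:Q\to Q$ a nonexpansive mapping, $A:Q\to\mathcal{H}$ a $\nu$-inverse strongly monotone operator with $\nu>0$, and $f:Q\to Q$ a contraction with coefficient $\rho\in[0,1[$. Assume that $\Omega:=F_{ix}(S)\cap S_{VI(A,Q)}$ is nonempty. Let $\{\alpha_n\}_{n\ge0}\subset]0,1]$, $\{\lambda_n\}_{n\ge0}\subset[0,2\nu]$ and $\{e_n\}_{n\ge0}\subset\mathcal{H}$ be three sequences such that: (i) $\alpha_n\to0$ and $\sum_{n=0}^{+\infty}\alpha_n=+\infty$; (ii) $0<\liminf_{n\to+\infty}\lambda_n\le\limsup_{n\to+\infty}\lambda_n<2\nu$; (iii) $\frac{\alpha_{n+1}-\alpha_n}{\alpha_n}\to0$ or $\sum_{n=0}^{+\infty}|\alpha_{n+1}-\alpha_n|<\infty$; (iv) $\frac{\lambda_{n+1}-\lambda_n}{\alpha_n}\to0$ or $\sum_{n=0}^{+\infty}|\lambda_{n+1}-\lambda_n|<\infty$; (v) $\frac{\|e_n\|}{\alpha_n}\to0$ or $\sum_{n=0}^{+\infty}\|e_n\|<\infty$. Then for every initial data $x_1\in Q$, the sequence $\{x_n\}$ generated by the iterative process $$x_{n+1}=P_Q\big(\alpha_nf(x_n)+(1-\alpha_n)SP_Q(x_n-\lambda_nAx_n)+e_n\big),\quad n\ge1,$$ converges strongly in $\mathcal{H}$ to $q^*$, the unique solution of the variational problem (VP): $q^*\in\Omega$ and $\langle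 f(q^* )-q^*,x-q^*\rangle\le0$ for all $x\in\Omega$.
   Context: $\mathcal{H}$ has inner product $\langle\cdot,\cdot\rangle$ and associated norm $\|\cdot\|$. Nonexpansive: $\|Sx-Sy\|\le\|x-y\|$ for all $x,y\in Q$. $\nu$-inverse strongly monotone: $\langle Ax-Ay,x-y\rangle\ge\nu\|Ax-Ay\|^2$ for all $x,y\in Q$. Contraction with coefficient $\rho$: $\|f(x)-f(y)\|\le\rho\|x-y\|$ for all $x,y\in Q$. $F_{ix}(S)=\{x\in Q: Sx=x\}$. $S_{VI(A,Q)}=\{q\in Q:\langle Aq,x-q\rangle\ge0\ \text{for every }x\in Q\}$. $P_Q:\mathcal{H}\to Q$ is the metric projection onto $Q$. Intervals: $]0,1]$ and $[0,1[$ are half-open. *)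

(* Defs.v *)
From HB Require Import structures.
From mathcomp Require Import all_boot all_order all_algebra.
From mathcomp Require Import all_classical all_reals all_analysis.

Set Implicit Arguments.
Unset Strict Implicit.
Unset Printing Implicit Defensive.

Import Order.TTheory GRing.Theory Num.Theory.
Import numFieldNormedType.Exports.

Local Open Scope classical_set_scope.
Local Open Scope ring_scope.

(* The norm of [H] is the one associated with the inner product [dot]; on a
   [completeNormedModType R] this makes [(H, dot)] a real Hilbert space. *)
Definition norm_associated (R : realType) (H : normedModType R)
    (dot : {dot H for idfun}) : Prop :=
  forall x : H, `|x| = Num.sqrt (dot x x).

(* An operator with domain [Q] is encoded as a total function on [H] of which
   only the values on [Q] are constrained. *)
Definition inverse_strongly_monotone (R : realType) (H : normedModType R)
    (dot : {dot H for idfun}) (nu : R) (Q : set H) (A : H -> H) : Prop :=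
  forall x y : H, Q x -> Q y ->
    nu * `|A x - A y| ^+ 2 <= dot (A x - A y) (x - y).

Definition fixed_points (T : Type) (Q : set T) (S : T -> T) : set T :=
  [set x | Q x /\ S x = x].

Definition VI_solutions (R : realType) (H : normedModType R)
    (dot : {dot H for idfun}) (A : H -> H) (Q : set H) : set H :=
  [set q | Q q /\ forall x, Q x -> 0 <= dot (A q) (x - q)].

Definition VP_solutions (R : realType) (H : normedModType R)
    (dot : {dot H for idfun}) (f : H -> H) (Omega : set H) : set H :=
  [set q | Omega q /\ forall x, Omega x -> dot (f q - q) (x - q) <= 0].

(* [xget] picks a nearest point of [Q]; its default value [0] is returned only
   if there is none, which does not happen when [Q] is a nonempty closed convex
   subset of a Hilbert space. *)
Definition metric_projection (R : realType) (H : normedModType R) (Q : set H)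
    (x : H) : H :=
  xget 0 [set p | Q p /\ forall y, Q y -> `|x - p| <= `|x - y|].

(* Main.v *)
Require Import Defs.
From HB Require Import structures.
From mathcomp Require Import all_boot all_order all_algebra.
From mathcomp Require Import all_classical all_reals all_analysis.
From mathcomp Require Import ring lra.

(** Let J_l x = P_Q (x - l A x).  For 0 < l < 2 nu this map is nonexpansive, its
    fixed points are the solutions of the variational inequality, and it brings
    every other point of Q strictly nearer to all of them
    (forward_backward_gap).  Hence T = S o J_nu is nonexpansive with fixed point
    set Omega (fixed_points_forward_backward), and the scheme is a viscosity
    perturbation of the maps S o J_(lambda n).

    The limit is found without weak compactness.  For u in Q, Halpern's path
    z_t = t u + (1 - t) T z_t is Cauchy as t decreases to 0, because |z_t - u|^2
    increases, is bounded, and its increments dominate the squares of those of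
    z_t (path_point_monotone).  Its limit r u is a fixed point of T, and each z_t
    already gives
      t <u - z_t, x - z_t> <= |x - T x| |x - z_t|
    for all x in Q (path_point_approx).  So <u - r u, x - r u> is at most any
    given eps as soon as x runs through a bounded set and |x - T x| is small
    (halpern_limit); this statement replaces the usual demiclosedness argument.
    On fixed points x it reads <u - r u, x - r u> <= 0, which makes r
    nonexpansive; the fixed point q of the contraction r o f solves the
    variational problem (viscosity_point), and two solutions coincide since f is
    a contraction (VP_solution_unique).

    The convergence of the iterates rests on one lemma about real sequences
    (cvg0_of_recursion), used twice.  Applied to |x_(n+1) - x_n|, it shows that
    the increments vanish, the variations of alpha, lambda and e being
    negligible.  Then x_n - S y_n tends to 0, where y_n = J_(lambda n) x_n, and
    forward_backward_gap forces x_n - y_n, and at last x_n - T x_n, to 0.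
    Applied to |x_n - q|^2, it gives the convergence to q: the remaining term
    <f q - q, x_(n+1) - q> is asymptotically nonpositive by the choice of q. *)

Set Implicit Arguments.
Unset Strict Implicit.
Unset Printing Implicit Defensive.

Import Order.TTheory GRing.Theory Num.Theory.
Import numFieldNormedType.Exports.

Local Open Scope classical_set_scope.
Local Open Scope ring_scope.

(** * Real sequences with negligible errors *)

Section RealSequences.
Context {R : realType}.
Implicit Types (a b d s dl : R^nat).

(** The conditions on the variations of the steps and on the errors each offer
    two alternatives, a ratio tending to 0 or a convergent series.  Sums of such
    terms mix both cases; this notion is stable under sums. *)
Definition negligible_wrt a b := exists d s,
  [/\ d @ \oo --> (0 : R), forall n, 0 <= s n, cvgn (series s)
    & forall n, `|b n| <= a n * d n + s n].

Lemma negligible_ratio_or_summable a b : (forall n, 0 < a n) ->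
  (b n / a n @[n --> \oo] --> (0 : R)) \/ cvgn [series `|b n|]_n ->
  negligible_wrt a b.
Proof.
move=> a0 [bd|bs].
- exists (fun n => `|b n / a n|), (fun=> 0); split => //.
  + by rewrite -[X in _ --> X](@normr0 _ R); exact: cvg_norm.
  + rewrite /series/= (_ : (fun n => _) = fun=> 0); first exact: is_cvg_cst.
    by apply/funext => n; rewrite big1.
  + move=> n; rewrite normrM normfV (gtr0_norm (a0 n)) mulrC.
    by rewrite divfK ?gt_eqF// addr0.
- exists (fun=> 0), (fun n => `|b n|); split => //; first exact: cvg_cst.
  by move=> n; rewrite mulr0 add0r.
Qed.

Lemma negligible_wrtD a b c :
  negligible_wrt a b -> negligible_wrt a c ->
  negligible_wrt a (fun n => b n + c n).
Proof.
move=> [d [s [d0 s0 cs bd]]] [d' [s' [d0' s0' cs' bd']]].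
exists (fun n => d n + d' n), (fun n => s n + s' n); split.
- by rewrite -[X in _ --> X](addr0 0); exact: cvgD.
- by move=> n; rewrite addr_ge0.
- exact: is_cvg_seriesD.
- by move=> n; have := bd n; have := bd' n; have := ler_normD (b n) (c n); nra.
Qed.

Lemma negligible_wrtZ a b k :
  negligible_wrt a b -> negligible_wrt a (fun n => k * b n).
Proof.
move=> [d [s [d0 s0 cs bd]]].
exists (fun n => `|k| * d n), (fun n => `|k| * s n); split.
- by rewrite -[X in _ --> X](mulr0 `|k|); apply: cvgM => //; exact: cvg_cst.
- by move=> n; rewrite mulr_ge0.
- exact: is_cvg_seriesZ.
- move=> n; rewrite normrM (le_trans (ler_wpM2l _ (bd n)))//.
  by rewrite mulrDr mulrCA.
Qed.

Lemma negligible_wrt_le a b c : (forall n, `|b n| <= `|c n|) ->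
  negligible_wrt a c -> negligible_wrt a b.
Proof.
move=> bc [d [s [d0 s0 cs bd]]]; exists d, s; split => // n.
exact: le_trans (bc n) (bd n).
Qed.

Lemma negligible_wrt_norm a b :
  negligible_wrt a b -> negligible_wrt a (fun n => `|b n|).
Proof. by apply: negligible_wrt_le => n; rewrite normr_id. Qed.

(** The bound on [b n.+1] involves [a n.+1], which need not be comparable to
    [a n].  Writing it as [a n] plus the increment of [a] makes the excess
    negligible, since the increment is. *)
Lemma negligible_wrt_shift a b : (forall n, 0 < a n <= 1) ->
  negligible_wrt a (fun n => a n.+1 - a n) -> negligible_wrt a b ->
  negligible_wrt a (fun n => b n.+1).
Proof.
move=> a01 da [d [s [d0 s0 cs bd]]].
have [K K0 dK] : exists2 K, 0 <= K & forall n, `|d n| <= K.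
  have [K [Kr dK]] := cvg_seq_bounded (cvgP _ d0).
  exists (`|K| + 1) => [|n]; first by rewrite addr_ge0.
  by apply: dK => //; rewrite (le_lt_trans (ler_norm K))// ltrDl.
have ad : negligible_wrt a (fun n => a n * d n.+1).
  apply: negligible_ratio_or_summable; first by move=> n; case/andP: (a01 n).
  left; rewrite (_ : (fun n => _) = (fun n => d n.+1)).
    by move: d0; rewrite -cvg_shiftS.
  by apply/funext => n; rewrite mulrC mulKf// gt_eqF//; case/andP: (a01 n).
have ss : negligible_wrt a (fun n => s n.+1).
  apply: negligible_ratio_or_summable; first by move=> n; case/andP: (a01 n).
  right; rewrite (_ : series _ = (fun n => series s n.+1 - s 0%N)).
    apply: is_cvgB; last exact: is_cvg_cst.
    by apply: (cvgP (limn (series s))); move: cs; rewrite -cvg_shiftS.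
  apply/funext => n; rewrite /series/= big_nat_recl//= addrAC subrr add0r.
  by apply: eq_bigr => i _; rewrite ger0_norm.
have := negligible_wrtD (negligible_wrtD (negligible_wrt_norm ad)
  (negligible_wrtZ K (negligible_wrt_norm da))) (negligible_wrt_norm ss).
apply: negligible_wrt_le => n.
rewrite [leRHS]ger0_norm; last by rewrite !addr_ge0// mulr_ge0.
have {}bd := bd n.+1; apply: le_trans bd _.
rewrite normrM (gtr0_norm (_ : 0 < a n)); last by case/andP: (a01 n).
have h1 : a n * d n.+1 <= a n * `|d n.+1|.
  by rewrite ler_wpM2l ?ler_norm//; case/andP: (a01 n) => /ltW.
have h2 : (a n.+1 - a n) * d n.+1 <= K * `|a n.+1 - a n|.
  by rewrite (le_trans (ler_norm _))// normrM mulrC ler_wpM2r.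
have := ler_norm (s n.+1); lra.
Qed.

Lemma negligible_wrt_cvg0 a b : (forall n, 0 < a n <= 1) ->
  negligible_wrt a b -> b @ \oo --> (0 : R).
Proof.
move=> a01 [d [s [d0 s0 cs bd]]].
apply/norm_cvg0P.
apply: (@squeeze_cvgr _ _ _ _ (fun=> 0) (fun n => `|d n| + s n)).
- apply: nearW => n; rewrite normr_ge0/= (le_trans (bd n))// lerD2r.
  have := ler_norm (d n); have := normr_ge0 (d n); have := a01 n; nra.
- exact: cvg_cst.
- rewrite -[X in _ --> X](addr0 0); apply: cvgD; last exact: cvg_series_cvg_0.
  by rewrite -[X in _ --> X](@normr0 _ R); exact: cvg_norm.
Qed.

(** The summable part of [b] adds up to a finite amount; without it, the
    recursion preserves every bound [B] such that [c * B] absorbs the terms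
    carrying the factor [a n]. *)
Lemma bounded_of_recursion a b s (c K : R) N : 0 < c -> 0 <= K ->
  (forall n, 0 < a n) -> (forall n, c * a n <= 1) -> negligible_wrt a b ->
  (forall n, (N <= n)%N ->
    s n.+1 <= (1 - c * a n) * s n + a n * K + b n) ->
  exists M, forall n, (N <= n)%N -> s n <= M.
Proof.
move=> c0 K0 a0 ca [d [t [d0 t0 ct bd]]] rec.
have [D dD] : exists D, forall n, d n <= D.
  have [D [Dr dD]] := cvg_seq_bounded (cvgP _ d0).
  exists (`|D| + 1) => n; rewrite (le_trans (ler_norm _))//.
  by apply: dD => //; rewrite (le_lt_trans (ler_norm D))// ltrDl.
pose B := Num.max (s N) ((K + D) / c).
have sB n : (N <= n)%N -> s n <= B + series t n.
  elim: n => [|n IH].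
    rewrite leqn0 => /eqP N0; rewrite /series/= big_geq// addr0.
    by rewrite /B -N0 le_max lexx.
  rewrite leq_eqVlt => /predU1P[<-|].
    rewrite (@le_trans _ _ B) ?le_max ?lexx// lerDl.
    by rewrite /series/= sumr_ge0.
  rewrite ltnS => Nn; have {}IH := IH Nn.
  rewrite seriesSr (le_trans (rec n Nn))//.
  have cB : K + D <= c * B.
    by rewrite mulrC -ler_pdivrMr// le_max lexx orbT.
  have := bd n; have := ler_norm (b n); have := dD n.
  have := a0 n; have := ca n.
  have : 0 <= series t n by rewrite /series/= sumr_ge0.
  move: (a n) (series t n) (s n) IH cB => an T sn IH cB T0 can an0 dn bn bdn.
  have h1 : (1 - c * an) * sn <= (1 - c * an) * (B + T).
    by rewrite ler_wpM2l// subr_ge0.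
  have h2 : an * (K + D) <= an * (c * B) by rewrite ler_wpM2l// ltW.
  have h3 : an * d n <= an * D by rewrite ler_wpM2l// ltW.
  have h4 : 0 <= (c * an) * T by rewrite mulr_ge0// mulr_ge0// ltW.
  lra.
exists (B + limn (series t)) => n /sB /le_trans; apply; rewrite lerD2l.
apply: nondecreasing_cvgn_le => //.
by apply: nondecreasing_series => k _ _; exact: t0.
Qed.

(** Past some rank, [s] minus a small level contracts by the factors
    [1 - c * a n <= expR (- (c * a n))], up to a small tail of a convergent
    series, and the product of these factors vanishes because the series of [a]
    diverges. *)
Lemma cvg0_of_recursion a b s dl (c : R) : 0 < c ->
  (forall n, 0 < a n) -> (forall n, c * a n <= 1) ->
  series a @ \oo --> +oo -> negligible_wrt a b ->
  (forall eps : R, 0 < eps -> \forall n \near \oo, dl n <= eps) ->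
  (forall n, 0 <= s n) ->
  (\forall n \near \oo, s n.+1 <= (1 - c * a n) * s n + a n * dl n + b n) ->
  s @ \oo --> (0 : R).
Proof.
move=> c0 a0 ca aoo [d [t [d0 t0 ct bd]]] dl0 s0 rec.
apply/cvgr0Pnorm_le => _/posnumP[eps]; pose h := eps%:num / 3.
have h0 : 0 < h by rewrite divr_gt0.
have ch0 : 0 < c * h / 2 by rewrite divr_gt0// mulr_gt0.
(* The budget [eps] is split evenly between the level [h], the product of the
   contraction factors, and the tail of the summable error.  At the level [h]
   the contraction gains [a n * (c * h)], which pays for [dl n] and [d n]. *)
have [N /= NP] : exists N, forall n, (N <= n)%N ->
    [/\ s n.+1 <= (1 - c * a n) * s n + a n * dl n + b n,
       dl n <= c * h / 2, d n <= c * h / 2 & limn (series t) - series t n <= h].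
  have tl : \forall n \near \oo, `|limn (series t) - series t n| <= h.
    by have /cvgrPdist_le := ct; apply.
  have /cvgr0Pnorm_le/(_ _ ch0) dh := d0.
  have [N _ NP] := filterI (filterI rec (dl0 _ ch0)) (filterI dh tl).
  exists N => n /NP[[? ?] [/= dn tn]]; split => //.
    exact: le_trans (ler_norm _) dn.
  exact: le_trans (ler_norm _) tn.
pose E := expR (R := R).
have main n : (N <= n)%N ->
    s n - h <= E (- (c * (series a n - series a N))) * s N
               + (series t n - series t N).
  elim: n => [|n IH].
    rewrite leqn0 => /eqP <-; rewrite !subrr mulr0 oppr0 /E expR0 mul1r addr0.
    by rewrite lerBlDr lerDl ltW.
  rewrite leq_eqVlt => /predU1P[<-|].
    rewrite !subrr mulr0 oppr0 /E expR0 mul1r addr0.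
    by rewrite lerBlDr lerDl ltW.
  rewrite ltnS => Nn; have {}IH := IH Nn; rewrite !seriesSr.
  have [recn dln dn _] := NP n Nn.
  rewrite (_ : - _ = - (c * a n) - c * (series a n - series a N)); last by ring.
  have T0 : 0 <= series t n - series t N.
    rewrite subr_ge0; apply: nondecreasing_series Nn => k _ _; exact: t0.
  have e1 : 1 - c * a n <= E (- (c * a n)) by exact: expR_ge1Dx.
  have E0 : 0 <= E (- (c * (series a n - series a N))) * s N.
    by rewrite mulr_ge0// expR_ge0.
  rewrite {1}/E expRD -/E -mulrA.
  move: (E (- (c * (_ - _))) * s N) (E (- (c * a n))) E0 e1 IH T0.
  move: (series t n) (series t N) (s n) (s n.+1) recn => Tn TN sn sn1 recn.
  move=> X Y X0 e1 IH T0.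
  have := bd n; have := ler_norm (b n); have := t0 n.
  have can := ca n; have an0 := a0 n => tn0 bn bdn.
  have h1 : (1 - c * a n) * (sn - h) <= (1 - c * a n) * (X + (Tn - TN)).
    by rewrite ler_wpM2l// subr_ge0.
  have h2 : a n * dl n <= a n * (c * h / 2) by rewrite ler_wpM2l// ltW.
  have h3 : a n * d n <= a n * (c * h / 2) by rewrite ler_wpM2l// ltW.
  have h4 : (1 - c * a n) * X <= Y * X by rewrite ler_wpM2r.
  have h5 : 0 <= c * a n * (Tn - TN) by rewrite mulr_ge0// mulr_ge0// ltW.
  lra.
near=> n; rewrite ger0_norm//.
have Nn : (N <= n)%N by near: n; exact: nbhs_infty_ge.
have A_n : series a N + s N / h / c <= series a n.
  by near: n; move/cvgryPge: aoo; exact.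
have [_ _ _ tN] := NP N (leqnn N).
have tn : series t n <= limn (series t).
  apply: nondecreasing_cvgn_le => //.
  by apply: nondecreasing_series => k _ _; exact: t0.
have := main n Nn; set x := c * _ => mn.
have xs : s N / h <= x by rewrite /x [leRHS]mulrC -ler_pdivrMr// lerBrDl.
have : E (- x) * s N <= h.
  rewrite /E expRN mulrC ler_pdivrMr ?expR_gt0// mulrC -ler_pdivrMr//.
  by rewrite (le_trans xs)// (le_trans _ (expR_ge1Dx x))// lerDr.
have : h * 3 = eps%:num by rewrite /h divfK.
lra.
Unshelve. all: by end_near. Qed.

Lemma cvg0_of_sqr (u : R^nat) : u n ^+ 2 @[n --> \oo] --> (0 : R) ->
  u @ \oo --> (0 : R).
Proof.
move=> u2; apply/cvgr0Pnorm_le => _/posnumP[eps].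
have e0 : 0 < eps%:num ^+ 2 by rewrite exprn_gt0.
have /cvgr0Pnorm_le/(_ _ e0) := u2; apply: filterS => n.
by rewrite normrX ler_pXn2r// nnegrE.
Qed.

Lemma limn_inf_gt0 a : bounded_fun a -> 0 < limn_inf a ->
  exists2 m, 0 < m & \forall n \near \oo, m <= a n.
Proof.
move=> ba; rewrite limn_infE// => /sup_gt [|_ [N _ <-] aN].
  by exists (infs a 0%N); exists 0%N.
exists (infs a N) => //; exists N => // n /= Nn.
apply: ge_inf; last by exists n.
have [l al] := bounded_fun_has_lbound ba.
by exists l => _ [k _ <-]; apply: al; exists k.
Qed.

Lemma limn_sup_lt a B : bounded_fun a -> limn_sup a < B ->
  exists2 m, m < B & \forall n \near \oo, a n <= m.
Proof.
move=> ba; rewrite limn_supE// => /inf_lt [|_ [N _ <-] aN].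
  by exists (sups a 0%N); exists 0%N.
exists (sups a N) => //; exists N => // n /= Nn.
apply: ub_le_sup; last by exists n.
have [l al] := bounded_fun_has_ubound ba.
by exists l => _ [k _ <-]; apply: al; exists k.
Qed.

End RealSequences.

(** * Inner product and norm *)

Section InnerProduct.
Context {R : realType} {H : normedModType R} (dot : {dot H for idfun}).
Hypothesis Hdot : norm_associated dot.
Implicit Types (u v w x y : H) (Q : set H).

Lemma dotC u v : dot u v = dot v u.
Proof. by rewrite hermC/= expr0 mul1r. Qed.

Lemma dot_norm u : dot u u = `|u| ^+ 2.
Proof.
rewrite Hdot sqr_sqrtr//; have [->|u0] := eqVneq u 0; first by rewrite linear0l.
by apply/ltW; exact: neq0_dnorm_gt0.
Qed.

Lemma dotDl u v w : dot (u + v) w = dot u w + dot v w.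
Proof. exact: linearDl. Qed.

Lemma dotDr u v w : dot u (v + w) = dot u v + dot u w.
Proof. exact: linearDr. Qed.

Lemma dotNl u v : dot (- u) v = - dot u v.
Proof. exact: linearNl. Qed.

Lemma dotNr u v : dot u (- v) = - dot u v.
Proof. exact: linearNr. Qed.

Lemma dotZl (k : R) u v : dot (k *: u) v = k * dot u v.
Proof. exact: linearZl_LR. Qed.

Lemma dotZr (k : R) u v : dot u (k *: v) = k * dot u v.
Proof. exact: linearZr_LR. Qed.

Definition dotE := (dotDl, dotDr, dotNl, dotNr, dotZl, dotZr).

(** Vector identities are proved by pairing both sides with an arbitrary vector,
    which turns them into identities in the base field. *)
Lemma dot_ext u v : (forall w, dot u w = dot v w) -> u = v.
Proof.
move=> uv; apply/eqP; rewrite -subr_eq0 -normr_eq0 -sqrf_eq0 -dot_norm.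
by rewrite dotDl dotNl uv subrr.
Qed.

Lemma sqr_normD u v : `|u + v| ^+ 2 = `|u| ^+ 2 + 2 * dot u v + `|v| ^+ 2.
Proof. rewrite -!dot_norm !dotE (dotC v u); ring. Qed.

Lemma sqr_normB u v : `|u - v| ^+ 2 = `|u| ^+ 2 - 2 * dot u v + `|v| ^+ 2.
Proof. rewrite sqr_normD dotNr normrN; ring. Qed.

Lemma cauchy_schwarz u v : dot u v <= `|u| * `|v|.
Proof.
have [->|v0] := eqVneq v 0; first by rewrite linear0r normr0 mulr0.
have [->|u0] := eqVneq u 0; first by rewrite linear0l normr0 mul0r.
have uv0 : 0 < `|u| * `|v| by rewrite mulr_gt0// normr_gt0.
have := sqr_ge0 `| `|v| *: u - `|u| *: v|.
rewrite sqr_normB !normrZ !normr_id !exprMn dotZl dotZr.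
rewrite (_ : _ + _ = 2 * (`|u| * `|v|) * (`|u| * `|v| - dot u v)).
  by rewrite pmulr_rge0 ?subr_ge0// mulr_gt0.
ring.
Qed.

Lemma cauchy_schwarz_norm u v : `|dot u v| <= `|u| * `|v|.
Proof.
rewrite ler_norml cauchy_schwarz andbT lerNl -dotNl.
by rewrite (le_trans (cauchy_schwarz _ _))// normrN.
Qed.

End InnerProduct.

(** * Metric projection onto a closed convex set *)

Section MetricProjection.
Context {R : realType} {H : completeNormedModType R} (dot : {dot H for idfun}).
Hypothesis Hdot : norm_associated dot.
Implicit Types (u v w x y p : H) (Q : set H).

Lemma convex_comb Q x y (t : R) : convex_set Q -> Q x -> Q y ->
  0 <= t <= 1 -> Q (t *: x + (1 - t) *: y).
Proof.
move=> cQ Qx Qy /andP[t0 t1].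
have := cQ x y (Itv01 t0 t1); rewrite !inE => /(_ Qx Qy).
by rewrite /conv/=.
Qed.

(** Minimizing sequences and Halpern's path both give increments controlled by a
    null sequence of squares. *)
Lemma cvg_of_sqr_dist (y : nat -> H) (b : R^nat) : b @ \oo --> (0 : R) ->
  (forall n m, `|y n - y m| ^+ 2 <= b n + b m) -> cvgn y.
Proof.
move=> b0 yb; apply/cauchy_cvgP/cauchy_exP => _/posnumP[e].
have e0 : 0 < e%:num ^+ 2 / 4 by rewrite divr_gt0// exprn_gt0.
have /cvgr0Pnorm_le/(_ _ e0) [N _ bN] := b0.
exists (y N); exists N => // n /= Nn; rewrite -ball_normE/=.
rewrite -(@ltr_pXn2r _ 2)// ?nnegrE//.
have := bN N (leqnn N); have := bN n Nn => /=.
have := ler_norm (b N); have := ler_norm (b n); have := yb N n; lra.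
Qed.

(** By the parallelogram identity, points almost realizing the infimum of the
    squared distance are close to each other, their midpoint being in [Q]. *)
Lemma nearest_point_exists Q x : closed Q -> convex_set Q -> Q !=set0 ->
  exists p, Q p /\ forall y, Q y -> `|x - p| <= `|x - y|.
Proof.
move=> clQ cQ [q0 Qq0].
pose D := [set `|x - y| ^+ 2 | y in Q]; pose d := inf D.
have lbD : lbound D 0 by move=> _ [y _ <-]; exact: sqr_ge0.
have D0 : D !=set0 by exists (`|x - q0| ^+ 2); exists q0.
have hD : has_inf D by split => //; exists 0.
have dD y : Q y -> d <= `|x - y| ^+ 2.
  by move=> Qy; apply: ge_inf; [exists 0|exists y].
have /choice[y yP] (n : nat) : exists y, Q y /\ `|x - y| ^+ 2 < d + n.+1%:R^-1.
  have [|_ [y Qy <-] yd] := @inf_adherent _ D n.+1%:R^-1 _ hD; first by [].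
  by exists y.
have y_cvg : cvgn y.
  apply: (@cvg_of_sqr_dist _ (fun n => 2 * n.+1%:R^-1)).
    rewrite -[X in _ --> X](mulr0 2); apply: cvgM; first exact: cvg_cst.
    exact: cvg_harmonic.
  move=> n m; have [Qn yn] := yP n; have [Qm ym] := yP m.
  have h2 : 0 <= (2^-1 : R) <= 1 by lra.
  have := dD _ (convex_comb cQ Qn Qm h2).
  rewrite (_ : x - _ = 2^-1 *: ((x - y n) + (x - y m))); last first.
    rewrite (_ : 1 - 2^-1 = 2^-1 :> R); last by lra.
    rewrite addrACA -opprD scalerBr !scalerDr -scalerDl; congr (_ - _).
    by rewrite (_ : 2^-1 + 2^-1 = 1 :> R) ?scale1r//; lra.
  rewrite (_ : y n - y m = (x - y m) - (x - y n)); last first.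
    by rewrite opprB [RHS]addrC subrKA.
  rewrite normrZ exprMn (sqr_normD Hdot (x - y n)) (sqr_normB Hdot (x - y m)).
  rewrite (dotC dot (x - y m) (x - y n)).
  rewrite normfV (ger0_norm (_ : 0 <= 2))// (_ : 2^-1 ^+ 2 = 1 / 4); last by lra.
  move: (n.+1%:R^-1) (m.+1%:R^-1) yn ym => a b yn ym; lra.
have Qp : Q (limn y).
  by apply: (closed_cvg _ clQ _ _ y_cvg); apply: nearW => n; case: (yP n).
exists (limn y); split => // z Qz.
have xp : `|x - limn y| ^+ 2 <= d.
  have c1 : `|x - y n| ^+ 2 @[n --> \oo] --> `|x - limn y| ^+ 2.
    by apply: cvgM; apply: cvg_norm; apply: cvgB => //; exact: cvg_cst.
  have c2 : d + n.+1%:R^-1 @[n --> \oo] --> d.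
    rewrite -[X in _ --> X]addr0; apply: cvgD; first exact: cvg_cst.
    exact: cvg_harmonic.
  apply: ler_cvg_to c1 c2 _; apply: nearW => n; exact: (ltW (yP n).2).
by rewrite -(@ler_pXn2r _ 2)// ?nnegrE// (le_trans xp)// dD.
Qed.

Section Projection.
Variable Q : set H.
Hypotheses (clQ : closed Q) (cQ : convex_set Q) (Q0 : Q !=set0).
Let P := metric_projection Q.

Lemma projection_nearest x : Q (P x) /\ forall y, Q y -> `|x - P x| <= `|x - y|.
Proof.
have [p pP] := nearest_point_exists x clQ cQ Q0.
exact: (@xgetI _ 0 [set p | Q p /\ forall y, Q y -> `|x - p| <= `|x - y|] p pP).
Qed.

Lemma projection_in x : Q (P x). Proof. exact: (projection_nearest x).1. Qed.

(** Moving from [P x] towards [y] inside [Q] cannot decrease the distance to [x],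
    and the square of this distance has derivative -2 times this product. *)
Lemma projection_obtuse x y : Q y -> dot (x - P x) (y - P x) <= 0.
Proof.
move=> Qy; have [Qp pmin] := projection_nearest x; set p := P x in Qp pmin *.
rewrite leNgt; apply/negP => a0; set a := dot _ _ in a0.
(* The step [a / b] would be optimal; adding [a] to the denominator keeps it
   below 1 and defined when [b = 0]. *)
pose b := `|y - p| ^+ 2; pose t := a / (a + b).
have b0 : 0 <= b by exact: sqr_ge0.
have ab0 : 0 < a + b by lra.
have t0 : 0 < t by rewrite divr_gt0.
have t1 : t <= 1 by rewrite ler_pdivrMr// mul1r lerDl.
have tab : t * (a + b) = a by rewrite divfK// gt_eqF.
have t01 : 0 <= t <= 1 by rewrite t1 ltW.
have := pmin _ (convex_comb cQ Qy Qp t01).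
rewrite -(@ler_pXn2r _ 2)// ?nnegrE//.
rewrite (_ : x - _ = (x - p) - t *: (y - p)); last first.
  by rewrite -addrA -opprD scalerBl scale1r scalerBr addrCA.
rewrite (sqr_normB Hdot (x - p)) (dotZr dot) -/a.
rewrite normrZ exprMn -/b (ger0_norm (ltW t0)).
have tb : t * b <= a by nra.
nra.
Qed.

Lemma projection_unique x p : Q p ->
  (forall y, Q y -> dot (x - p) (y - p) <= 0) -> P x = p.
Proof.
move=> Qp pP; have := pP _ (projection_in x); have := projection_obtuse x Qp.
set z := P x => h1 h2; apply/eqP.
rewrite -subr_eq0 -normr_eq0 -sqrf_eq0 eq_le sqr_ge0 andbT -(dot_norm Hdot).
have -> : dot (z - p) (z - p) = dot (x - z) (p - z) + dot (x - p) (z - p).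
  by rewrite !(dotE dot); ring.
lra.
Qed.

Lemma projection_id x : Q x -> P x = x.
Proof.
by move=> Qx; apply: projection_unique => // y _; rewrite subrr (linear0l dot).
Qed.

Lemma projection_firm x y : `|P x - P y| ^+ 2 <= dot (x - y) (P x - P y).
Proof.
have := projection_obtuse x (projection_in y).
have := projection_obtuse y (projection_in x).
rewrite -(dot_norm Hdot); set a := P x; set b := P y => h1 h2.
have -> : dot (x - y) (a - b) =
    dot (a - b) (a - b) - (dot (x - a) (b - a) + dot (y - b) (a - b)).
  by rewrite !(dotE dot); ring.
lra.
Qed.

Lemma projection_nonexpansive x y : `|P x - P y| <= `|x - y|.
Proof.
have := le_trans (projection_firm x y) (cauchy_schwarz Hdot _ _).
have [->|] := eqVneq (P x - P y) 0; first by rewrite normr0.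
by rewrite -normr_gt0 => h; rewrite expr2 ler_pM2r.
Qed.

End Projection.
End MetricProjection.

(** * Halpern's path *)

Section HalpernPath.
Context {R : realType} {H : completeNormedModType R} (dot : {dot H for idfun}).
Hypothesis Hdot : norm_associated dot.
Implicit Types (u v w x y z p : H) (Q : set H).

Lemma contraction_fixed_point Q (g : H -> H) (r : R) :
  closed Q -> Q !=set0 -> 0 <= r < 1 -> (forall x, Q x -> Q (g x)) ->
  (forall x y, Q x -> Q y -> `|g x - g y| <= r * `|x - y|) ->
  exists p, Q p /\ g p = p.
Proof.
move=> clQ Q0 /andP[r0 r1] gQ glip.
have gg : is_contraction (mkfun_fun gQ : {fun Q >-> Q}).
  by exists (NngNum r0); split => // -[x y] /= [Qx Qy]; exact: glip.
by have [p Qp pE] := banach_fixed_point gg clQ Q0; exists p.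
Qed.

Section Path.
Variables (Q : set H) (T : H -> H) (p0 : H).
Hypotheses (clQ : closed Q) (cQ : convex_set Q).
Hypotheses (TQ : forall x, Q x -> Q (T x))
  (Tnonexp : forall x y, Q x -> Q y -> `|T x - T y| <= `|x - y|)
  (Qp0 : Q p0) (Tp0 : T p0 = p0).

(** A relation, because the point of parameter [t] comes from Banach's theorem. *)
Definition path_point u (t : R) z := Q z /\ z = t *: u + (1 - t) *: T z.

Lemma path_point_exists u t : Q u -> 0 < t <= 1 -> exists z, path_point u t z.
Proof.
move=> Qu /andP[t0 t1]; have t01 : 0 <= t <= 1 by rewrite t1 ltW.
have [||||z [Qz zE]] :=
  @contraction_fixed_point Q (fun z => t *: u + (1 - t) *: T z) (1 - t) clQ.
- by exists u.
- by rewrite subr_ge0 t1/= gtrBl.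
- by move=> x Qx; apply: convex_comb => //; exact: TQ.
- move=> x y Qx Qy; rewrite opprD addrACA subrr add0r -scalerBr normrZ.
  by rewrite ger0_norm ?subr_ge0// ler_wpM2l ?subr_ge0// Tnonexp.
by exists z.
Qed.

Lemma path_point_bounded u t z : 0 < t <= 1 -> path_point u t z ->
  `|z - p0| <= `|u - p0|.
Proof.
move=> /andP[t0 t1] [Qz zE].
have : `|z - p0| <= t * `|u - p0| + (1 - t) * `|z - p0|.
  rewrite {1}zE (_ : _ - p0 = t *: (u - p0) + (1 - t) *: (T z - p0)); last first.
    by rewrite !scalerBr addrACA -opprD -scalerDl subrKC scale1r.
  rewrite (le_trans (ler_normD _ _))// !normrZ (gtr0_norm t0).
  rewrite ger0_norm ?subr_ge0// lerD2l ler_wpM2l ?subr_ge0//.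
  by rewrite -{1}Tp0 Tnonexp.
nra.
Qed.

(** Since [T] is nonexpansive, [id - T] is monotone; on the path
    [(1 - t) (z - T z) = t (u - z)], and monotonicity between the parameters [t]
    and [s] comes down to [0 <= dot (z' - u) (z - z')].
    Expanding [|(z' - u) + (z - z')|^2] then gives the claim. *)
Lemma path_point_monotone u s t z z' : 0 < t -> t < s -> s <= 1 ->
  path_point u t z -> path_point u s z' ->
  `|z - z'| ^+ 2 <= `|z - u| ^+ 2 - `|z' - u| ^+ 2.
Proof.
move=> t0 ts s1 [Qz zE] [Qz' zE'].
suff h : dot u (z - z') <= dot z' (z - z').
  rewrite (_ : z - u = (z' - u) + (z - z')); last by rewrite [RHS]addrC subrKA.
  rewrite (sqr_normD Hdot (z' - u)) (dotDl dot) (dotNl dot).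
  move: (dot u _) (dot z' _) h => a b; nra.
have T1 : dot (T z) (z - z') - dot (T z') (z - z') <= `|z - z'| ^+ 2.
  rewrite -(dotNl dot) -(dotDl dot).
  rewrite (le_trans (cauchy_schwarz Hdot _ _))// expr2 ler_wpM2r// Tnonexp//.
have n0 : 0 <= `|z - z'| ^+ 2 by exact: sqr_ge0.
have a2 : `|z - z'| ^+ 2 = dot z (z - z') - dot z' (z - z').
  by rewrite -(dot_norm Hdot) {1}(dotDl dot) (dotNl dot).
have dz : dot z (z - z') = t * dot u (z - z') + (1 - t) * dot (T z) (z - z').
  by rewrite {1}zE (dotDl dot) !(dotZl dot).
have dz' : dot z' (z - z') = s * dot u (z - z') + (1 - s) * dot (T z') (z - z').
  by rewrite {1}zE' (dotDl dot) !(dotZl dot).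
rewrite a2 in T1 n0; move: T1 n0; rewrite {a2} dz dz'.
move: (dot u _) (dot (T z) _) (dot (T z') _) => U X X' T1 n0.
suff y0 : 0 <= X' - U.
  suff : 0 <= (1 - s) * (X' - U) by lra.
  by rewrite mulr_ge0// subr_ge0.
have t1 : 0 <= 1 - t by lra.
have h1 : t * (X - U) <= s * (X' - U) by lra.
have h2 : (1 - s) * (X' - U) <= (1 - t) * (X - U) by lra.
have h3 : (1 - t) * (t * (X - U)) <= (1 - t) * (s * (X' - U)).
  by rewrite ler_wpM2l.
have h4 : t * ((1 - s) * (X' - U)) <= t * ((1 - t) * (X - U)).
  by rewrite ler_wpM2l// ltW.
have : 0 <= (s - t) * (X' - U) by lra.
by rewrite pmulr_rge0// subr_gt0.
Qed.

(** Were [x] a fixed point, [z - x] would be a mix of [u - x] and of a vector not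
    longer than itself, so [dot (u - z) (x - z) <= 0]; a residual [x - T x]
    perturbs this by a product of norms. *)
Lemma path_point_approx u t z x : 0 < t <= 1 -> path_point u t z -> Q x ->
  t * dot (u - z) (x - z) <= `|x - T x| * `|x - z|.
Proof.
move=> /andP[t0 t1] [Qz zE] Qx.
have T1 : dot (T z - x) (z - x) <= (`|z - x| + `|x - T x|) * `|z - x|.
  rewrite (le_trans (cauchy_schwarz Hdot _ _))// ler_wpM2r//.
  rewrite (_ : T z - x = (T z - T x) - (x - T x)); last first.
    by rewrite opprB subrKA.
  by rewrite (le_trans (ler_normB _ _))// lerD2r Tnonexp.
have n2 : `|z - x| * `|z - x| = dot z (z - x) - dot x (z - x).
  by rewrite -expr2 -(dot_norm Hdot) {1}(dotDl dot) (dotNl dot).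
have dz : dot z (z - x) = t * dot u (z - x) + (1 - t) * dot (T z) (z - x).
  by rewrite {1}zE (dotDl dot) !(dotZl dot).
have -> : dot (u - z) (x - z) = dot z (z - x) - dot u (z - x).
  by rewrite -(opprB z x) (dotNr dot) (dotDl dot) (dotNl dot) opprD opprK addrC.
rewrite (distrC x z); move: T1; rewrite mulrDl n2 (dotDl dot) (dotNl dot).
set U := dot u _ in dz *; set X := dot (T z) _ in dz *; set Z := dot z _ in dz *.
set Y := dot x _; set K := _ * `|z - x| => T1.
have K0 : 0 <= K by rewrite mulr_ge0.
have : (1 - t) * (X - Y) <= (1 - t) * (Z - Y + K).
  by rewrite ler_wpM2l ?subr_ge0//.
have : 0 <= t * K by rewrite mulr_ge0// ltW.
lra.
Qed.

(** The last clause is a uniform version of: the limit superior of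
    [dot (u - z) (x n - z)] is nonpositive along bounded sequences with
    [x n - T (x n)] tending to 0.  It transfers [path_point_approx] from a path
    point close to [z], whose parameter fixes [dl]. *)
Lemma halpern_limit u : Q u -> exists z, [/\ Q z, T z = z
  & forall M eps : R, 0 < eps -> exists2 dl : R, 0 < dl &
      forall x, Q x -> `|x - z| <= M -> `|x - T x| <= dl ->
        dot (u - z) (x - z) <= eps].
Proof.
move=> Qu.
have t01 n : 0 < (n.+1%:R^-1 : R) <= 1.
  by rewrite invr_gt0 ltr0n/= invf_le1 ?ltr0n// ler1n.
have /choice[z zP] (n : nat) := path_point_exists Qu (t01 n).
(* The parameters are 1/(n+1): they start at 1, where the path is at [u], and
   decrease to 0. *)
pose a n := `|z n - u| ^+ 2.
have az n m : (n <= m)%N -> `|z n - z m| ^+ 2 <= a m - a n.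
  rewrite leq_eqVlt => /predU1P[->|nm].
    by rewrite !subrr normr0 expr0n.
  rewrite distrC; apply: path_point_monotone (zP m) (zP n).
  - by case/andP: (t01 m).
  - by rewrite ltf_pV2 ?posrE ?ltr0n// ltr_nat ltnS.
  - by case/andP: (t01 n).
have a_cvg : cvgn a.
  apply: nondecreasing_is_cvgn.
    by move=> n m /az h; rewrite -subr_ge0; apply: le_trans h; exact: sqr_ge0.
  exists ((`|u - p0| + `|u - p0|) ^+ 2) => _ [n _ <-].
  rewrite /a ler_pXn2r ?nnegrE ?addr_ge0//.
  rewrite (_ : z n - u = (z n - p0) - (u - p0)); last by rewrite opprB subrKA.
  by rewrite (le_trans (ler_normB _ _))// lerD2r (path_point_bounded (t01 n)).
have z_cvg : cvgn z.
  apply: (@cvg_of_sqr_dist _ _ _ (fun n => `|a n - limn a|)).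
    rewrite -[X in _ --> X](@normr0 _ R) -(subrr (limn a)); apply: cvg_norm.
    by apply: cvgB; [exact: a_cvg|exact: cvg_cst].
  move=> n m; wlog nm : n m / (n <= m)%N => [W|].
    by case/orP: (leq_total n m) => /W // h; rewrite distrC [leRHS]addrC.
  rewrite (le_trans (az _ _ nm))//.
  rewrite (_ : a m - a n = (a m - limn a) - (a n - limn a)); last first.
    by rewrite opprB subrKA.
  by rewrite (le_trans (ler_norm _))// (le_trans (ler_normB _ _))// addrC.
set zl := limn z in z_cvg; have Qzl : Q zl.
  by apply: (closed_cvg _ clQ _ _ z_cvg); apply: nearW => n; case: (zP n).
have zn_small e : 0 < e -> \forall n \near \oo, `|z n - zl| <= e.
  move=> e0; have /cvgrPdist_le/(_ _ e0) := z_cvg.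
  by apply: filterS => n; rewrite distrC.
exists zl; split => //.
- apply/eqP; rewrite -subr_eq0 -normr_eq0 eq_le normr_ge0 andbT.
  apply/ler_addgt0Pl => _/posnumP[e]; rewrite addr0.
  pose C := `|u - p0|.
  have e4 : 0 < e%:num / 4 by rewrite divr_gt0.
  have C0 : 0 < 2 * C + 1 by rewrite ltr_pwDr// mulr_ge0// normr_ge0.
  have tn : \forall n \near \oo, (n.+1%:R^-1 : R) <= e%:num / 4 / (2 * C + 1).
    have /cvgr0Pnorm_le/(_ (e%:num / 4 / (2 * C + 1))) := @cvg_harmonic R.
    move/(_ (divr_gt0 e4 C0)); apply: filterS => n /=.
    by apply: le_trans; exact: ler_norm.
  have [n _ /(_ n (leqnn n)) [/= zn tn']] := filterI (zn_small _ e4) tn.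
  have [Qz zE] := zP n.
  have Tn : `|T (z n) - z n| <= e%:num / 4.
    rewrite (_ : T (z n) - z n = n.+1%:R^-1 *: (T (z n) - u)); last first.
      rewrite {2}zE scalerBl scale1r scalerBr opprD opprB.
      by rewrite addrCA subrKC addrC.
    rewrite normrZ (gtr0_norm (_ : 0 < n.+1%:R^-1))//.
    have TzC : `|T (z n) - u| <= 2 * C + 1.
      rewrite (_ : T (z n) - u = (T (z n) - p0) - (u - p0)); last first.
        by rewrite opprB subrKA.
      rewrite (le_trans (ler_normB _ _))//.
      have := path_point_bounded (t01 n) (zP n); rewrite -/C => h.
      have : `|T (z n) - p0| <= `|z n - p0| by rewrite -{1}Tp0 Tnonexp.
      lra.
    rewrite (le_trans (ler_pM _ _ tn' TzC))// ?invr_ge0//.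
    by rewrite divfK// gt_eqF.
  rewrite (_ : T zl - zl = (T zl - T (z n)) + (T (z n) - z n) + (z n - zl)).
    have := Tnonexp Qzl Qz; rewrite (distrC zl) => h1.
    rewrite (le_trans (ler_normD _ _))//.
    rewrite (le_trans (lerD (ler_normD _ _) (lexx _)))//; lra.
  by rewrite -addrA subrKA subrKA.
- move=> M eps eps0.
  pose K := `|M| + 1; have K0 : 0 < K by rewrite ltr_pwDr.
  pose L := K + `|u - zl|; have L0 : 0 < L by rewrite ltr_pwDl.
  have e1 : 0 < Num.min 1 (eps / 2 / L).
    by rewrite lt_min ltr01/= !divr_gt0.
  have [n _ /(_ n (leqnn n)) /= zn] := zn_small _ e1.
  move: zn; rewrite le_min => /andP[zn1 zn2].
  have [Qz zE] := zP n; have [tn0 tn1] := andP (t01 n).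
  set t : R := n.+1%:R^-1 in zE tn0 tn1.
  exists (eps / 2 * t / K); first by rewrite !mulr_gt0// invr_gt0.
  move=> x Qx xM xT.
  have xzn : `|x - z n| <= K.
    rewrite (_ : x - z n = (x - zl) - (z n - zl)); last by rewrite opprB subrKA.
    by rewrite (le_trans (ler_normB _ _))// lerD// (le_trans xM)// ler_norm.
  have h1 : dot (u - z n) (x - z n) <= eps / 2.
    rewrite -(ler_pM2l tn0) (le_trans (path_point_approx (t01 n) (zP n) Qx))//.
    rewrite (le_trans (ler_pM _ _ xT xzn))//.
    by rewrite divfK ?gt_eqF// mulrC.
  have h2 := cauchy_schwarz Hdot (z n - zl) (x - z n).
  have h3 := cauchy_schwarz Hdot (u - zl) (z n - zl).
  have -> : dot (u - zl) (x - zl) = dot (u - z n) (x - z n)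
      + dot (z n - zl) (x - z n) + dot (u - zl) (z n - zl).
    by rewrite !(dotE dot); ring.
  have h4 : `|z n - zl| * L <= eps / 2 by rewrite -ler_pdivlMr.
  have h5 : `|z n - zl| * `|x - z n| <= `|z n - zl| * K by rewrite ler_wpM2l.
  rewrite /L in h4; lra.
Qed.

End Path.
End HalpernPath.

(** * The forward-backward operator *)

Section ForwardBackward.
Context {R : realType} {H : completeNormedModType R} (dot : {dot H for idfun}).
Hypothesis Hdot : norm_associated dot.
Variables (Q : set H) (A : H -> H) (nu : R).
Hypotheses (clQ : closed Q) (cQ : convex_set Q) (Q0 : Q !=set0).
Hypotheses (nu0 : 0 < nu) (Aism : inverse_strongly_monotone dot nu Q A).
Implicit Types (x y q : H) (l m : R).

Definition forward_backward (l : R) (x : H) : H :=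
  metric_projection Q (x - l *: A x).
Local Notation J := forward_backward.

Lemma ism_lipschitz x y : Q x -> Q y -> nu * `|A x - A y| <= `|x - y|.
Proof.
move=> Qx Qy.
have := le_trans (Aism Qx Qy) (cauchy_schwarz Hdot _ _).
have [->|] := eqVneq (A x - A y) 0; first by rewrite normr0 mulr0.
by rewrite -normr_gt0 => h; rewrite expr2 mulrCA ler_pM2l.
Qed.

(** Expanding the square, inverse strong monotonicity makes the cross term beat
    the quadratic one as long as [l <= 2 * nu]. *)
Lemma ism_forward l x y : 0 <= l -> Q x -> Q y ->
  `|(x - y) - l *: (A x - A y)| ^+ 2
    <= `|x - y| ^+ 2 - l * (2 * nu - l) * `|A x - A y| ^+ 2.
Proof.
move=> l0 Qx Qy; rewrite (sqr_normB Hdot (x - y)) (dotZr dot) (dotC dot (x - y)).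
rewrite normrZ exprMn (ger0_norm l0).
have := ler_wpM2l l0 (Aism Qx Qy); lra.
Qed.

Lemma forward_backward_in l x : Q (J l x).
Proof. exact: projection_in. Qed.

Lemma forward_backward_nonexpansive l x y : 0 <= l <= 2 * nu -> Q x -> Q y ->
  `|J l x - J l y| <= `|x - y|.
Proof.
move=> /andP[l0 l2] Qx Qy.
apply: le_trans (projection_nonexpansive Hdot clQ cQ Q0 _ _) _.
rewrite (_ : _ - _ = (x - y) - l *: (A x - A y)); last first.
  by apply: (dot_ext Hdot) => w; rewrite !(dotE dot); ring.
rewrite -(@ler_pXn2r _ 2)// ?nnegrE//.
rewrite (le_trans (ism_forward l0 Qx Qy))// gerBl.
by rewrite !mulr_ge0// subr_ge0.
Qed.

Lemma forward_backward_fixed l q : 0 <= l -> VI_solutions dot A Q q -> J l q = q.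
Proof.
move=> l0 [Qq qVI]; apply: (projection_unique Hdot clQ cQ Q0 Qq) => y Qy.
rewrite (addrC q) addrK (dotNl dot) (dotZl dot) oppr_le0.
by rewrite mulr_ge0// qVI.
Qed.

Lemma fixed_VI_solution l q : 0 < l -> J l q = q -> VI_solutions dot A Q q.
Proof.
move=> l0 qJ; split; first by rewrite -qJ; exact: forward_backward_in.
move=> y Qy; have := projection_obtuse Hdot clQ cQ Q0 (q - l *: A q) Qy.
rewrite -/(J l q) qJ (addrC q) addrK (dotNl dot) (dotZl dot) oppr_le0.
by rewrite pmulr_rge0.
Qed.

(** Firm nonexpansiveness of the projection combined with [ism_forward].  The two
    extra terms on the left are what shows that [x - J l x] is small when [J l]
    brings [x] hardly nearer to a solution. *)
Lemma forward_backward_gap l x q : 0 <= l -> Q x -> VI_solutions dot A Q q ->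
  `|J l x - q| ^+ 2 + l * (2 * nu - l) * `|A x - A q| ^+ 2
    + `|(x - J l x) - l *: (A x - A q)| ^+ 2 <= `|x - q| ^+ 2.
Proof.
move=> l0 Qx qVI; have := ism_forward l0 Qx qVI.1.
have := projection_firm Hdot clQ cQ Q0 (x - l *: A x) (q - l *: A q).
rewrite -/(J l x) -/(J l q) (forward_backward_fixed l0 qVI).
set a := (x - q) - l *: (A x - A q); set b := J l x - q.
rewrite (_ : _ - _ = a); last first.
  by apply: (dot_ext Hdot) => w; rewrite !(dotE dot); ring.
rewrite (_ : x - J l x - _ = a - b); last first.
  by apply: (dot_ext Hdot) => w; rewrite !(dotE dot); ring.
rewrite (sqr_normB Hdot a); lra.
Qed.

Lemma forward_backward_step l m x : `|J m x - J l x| <= `|m - l| * `|A x|.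
Proof.
apply: le_trans (projection_nonexpansive Hdot clQ cQ Q0 _ _) _.
rewrite (_ : _ - _ = - ((m - l) *: A x)) ?normrN ?normrZ//.
by apply: (dot_ext Hdot) => w; rewrite !(dotE dot); ring.
Qed.

(** Compares the residuals at two step lengths, so that the varying steps of the
    scheme can be traded for a fixed one.  Adding the obtuse-angle inequalities
    at [J l x] and [J m x], weighted by [m] and [l], eliminates [A x]. *)
Lemma forward_backward_residual l m x : 0 <= l -> 0 <= m ->
  l * `|J m x - J l x| <= `|m - l| * `|x - J l x|.
Proof.
move=> l0 m0.
have := projection_obtuse Hdot clQ cQ Q0 (x - l *: A x) (forward_backward_in m x).
have := projection_obtuse Hdot clQ cQ Q0 (x - m *: A x) (forward_backward_in l x).
rewrite -/(J l x) -/(J m x); set y := J l x; set p := J m x => h1 h2.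
have [->|] := eqVneq (p - y) 0; first by rewrite normr0 mulr0 mulr_ge0.
rewrite -normr_gt0 => py; rewrite -(ler_pM2r py) -mulrA -expr2.
have h3 : l * `|p - y| ^+ 2 <= (l - m) * dot (x - y) (p - y).
  have := ler_wpM2l l0 h1; have := ler_wpM2l m0 h2.
  rewrite -(dot_norm Hdot) !mulr0 !(dotE dot) (dotC dot p y); lra.
rewrite (le_trans h3)// (le_trans (ler_norm _))// normrM distrC -mulrA.
by rewrite ler_wpM2l// (cauchy_schwarz_norm Hdot).
Qed.

(** If [S (J l z) = z], then [J l] does not bring [z] nearer to a common solution
    [q], and [forward_backward_gap] leaves no room for [J l z != z]. *)
Lemma fixed_points_forward_backward (S : H -> H) l :
  0 < l < 2 * nu -> (forall x, Q x -> Q (S x)) ->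
  (forall x y, Q x -> Q y -> `|S x - S y| <= `|x - y|) ->
  (fixed_points Q S `&` VI_solutions dot A Q) !=set0 ->
  fixed_points Q (S \o J l) = fixed_points Q S `&` VI_solutions dot A Q.
Proof.
move=> /andP[l0 l2] SQ Sne [q [[Qq Sq] qVI]]; apply/seteqP.
split => z /=; last first.
  case=> -[Qz Sz] zVI; split => //=.
  by rewrite (forward_backward_fixed (ltW l0) zVI).
move=> [Qz /= Tz]; have QJ := forward_backward_in l z.
suff Jz : J l z = z.
  by rewrite Jz in Tz; split; [split|exact: fixed_VI_solution l0 Jz].
have zq : `|z - q| <= `|J l z - q| by rewrite -{1}Tz -{1}Sq Sne.
have := forward_backward_gap (ltW l0) Qz qVI.
set D := A z - A q; set V := _ - l *: D => gap.
have zq2 : `|z - q| ^+ 2 <= `|J l z - q| ^+ 2 by rewrite ler_pXn2r ?nnegrE.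
have c0 : 0 < l * (2 * nu - l) by rewrite mulr_gt0// subr_gt0.
have D2 := mulr_ge0 (ltW c0) (sqr_ge0 `|D|); have V2 := sqr_ge0 `|V|.
have /eqP V0 : `|V| ^+ 2 == 0 by rewrite eq_le V2 andbT; lra.
have /eqP D0 : `|D| ^+ 2 == 0.
  rewrite eq_le sqr_ge0 andbT -(ler_pM2l c0) mulr0; lra.
move: V0 D0 => /eqP; rewrite sqrf_eq0 normr_eq0 => /eqP V0 /eqP.
rewrite sqrf_eq0 normr_eq0 => /eqP D0.
by move: V0; rewrite /V D0 scaler0 subr0 => /subr0_eq.
Qed.

End ForwardBackward.

(** * The solution of the variational problem *)

Section ViscosityPoint.
Context {R : realType} {H : completeNormedModType R} (dot : {dot H for idfun}).
Hypothesis Hdot : norm_associated dot.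
Implicit Types (u v w x y z p : H) (Q : set H).

(** The limits of Halpern's paths define a map [r] of [Q] into the fixed points of
    [T], which is nonexpansive by the obtuse-angle inequality; [q] is the fixed
    point of the contraction [r \o f]. *)
Lemma viscosity_point Q (T f : H -> H) (rho : R) :
  closed Q -> convex_set Q -> (forall x, Q x -> Q (T x)) ->
  (forall x y, Q x -> Q y -> `|T x - T y| <= `|x - y|) ->
  fixed_points Q T !=set0 ->
  0 <= rho < 1 -> (forall x, Q x -> Q (f x)) ->
  (forall x y, Q x -> Q y -> `|f x - f y| <= rho * `|x - y|) ->
  exists q, fixed_points Q T q /\
    forall M eps : R, 0 < eps -> exists2 dl : R, 0 < dl &
      forall x, Q x -> `|x - q| <= M -> `|x - T x| <= dl ->
        dot (f q - q) (x - q) <= eps.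
Proof.
move=> clQ cQ TQ Tne [p [Qp Tp]] rho01 fQ flip.
have /choice[r rP] u : exists z, Q u -> [/\ Q z, T z = z
  & forall M eps : R, 0 < eps -> exists2 dl : R, 0 < dl &
      forall x, Q x -> `|x - z| <= M -> `|x - T x| <= dl ->
        dot (u - z) (x - z) <= eps].
  have [Qu|nQu] := pselect (Q u); last by exists u.
  by have [z zP] := halpern_limit Hdot clQ cQ TQ Tne Qp Tp Qu; exists z.
have r_obtuse u z : Q u -> Q z -> T z = z -> dot (u - r u) (z - r u) <= 0.
  move=> Qu Qz Tz; have [_ _ ruP] := rP u Qu.
  apply/ler_addgt0Pl => eps eps0; rewrite addr0.
  have [dl dl0] := ruP `|z - r u| _ eps0; apply => //.
  by rewrite Tz subrr normr0 ltW.
have [||||q [Qq qE]] := @contraction_fixed_point _ _ Q (r \o f) rho clQ.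
- by exists p.
- by [].
- by move=> x Qx /=; case: (rP _ (fQ x Qx)).
- move=> x y Qx Qy /=; apply: le_trans (flip x y Qx Qy).
  have [Qx' Tx' _] := rP _ (fQ x Qx); have [Qy' Ty' _] := rP _ (fQ y Qy).
  have := r_obtuse _ _ (fQ x Qx) Qy' Ty'; have := r_obtuse _ _ (fQ y Qy) Qx' Tx'.
  move: (f x) (f y) (r (f x)) (r (f y)) => u v a b h1 h2.
  have h : `|a - b| ^+ 2 <= dot (u - v) (a - b).
    rewrite -(dot_norm Hdot).
    have -> : dot (u - v) (a - b) =
      dot (a - b) (a - b) - (dot (u - a) (b - a) + dot (v - b) (a - b)).
      by rewrite !(dotE dot); ring.
    lra.
  have := le_trans h (cauchy_schwarz Hdot _ _).
  have [->|] := eqVneq (a - b) 0; first by rewrite normr0.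
  by rewrite -normr_gt0 => h'; rewrite expr2 ler_pM2r.
exists q; have [_ Tq qP] := rP _ (fQ q Qq); rewrite /= in qE; rewrite qE in Tq qP.
by split.
Qed.

(** Adding the two variational inequalities bounds [|q - q'|^2] by
    [dot (f q - f q') (q - q')]. *)
Lemma VP_solution_unique (f : H -> H) (rho : R) Q (Omega : set H) q q' :
  rho < 1 -> (forall x y, Q x -> Q y -> `|f x - f y| <= rho * `|x - y|) ->
  Omega `<=` Q -> VP_solutions dot f Omega q -> VP_solutions dot f Omega q' ->
  q = q'.
Proof.
move=> rho1 flip OQ [Oq qVP] [Oq' q'VP].
have h1 := qVP _ Oq'; have h2 := q'VP _ Oq.
apply/eqP; rewrite -subr_eq0 -normr_eq0.
have h3 : `|q - q'| ^+ 2 <= dot (f q - f q') (q - q').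
  rewrite -(dot_norm Hdot).
  have -> : dot (f q - f q') (q - q') =
    dot (q - q') (q - q') - (dot (f q - q) (q' - q) + dot (f q' - q') (q - q')).
    by rewrite !(dotE dot); ring.
  lra.
have h4 : `|q - q'| ^+ 2 <= rho * `|q - q'| ^+ 2.
  rewrite (le_trans h3)// (le_trans (cauchy_schwarz Hdot _ _))//.
  by rewrite expr2 mulrA ler_wpM2r// flip//; apply: OQ.
rewrite -sqrf_eq0 eq_le sqr_ge0 andbT.
have := sqr_ge0 `|q - q'|; nra.
Qed.

End ViscosityPoint.

(** * Asymptotics of the iterates *)

Section Iteration.
Context {R : realType} {H : completeNormedModType R} (dot : {dot H for idfun}).
Hypothesis Hdot : norm_associated dot.
Variables (Q : set H) (S A f : H -> H) (nu rho : R).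
Hypotheses (clQ : closed Q) (cQ : convex_set Q) (Q0 : Q !=set0).
Hypotheses (SQ : forall x, Q x -> Q (S x))
  (Sne : forall x y, Q x -> Q y -> `|S x - S y| <= `|x - y|).
Hypotheses (nu0 : 0 < nu) (Aism : inverse_strongly_monotone dot nu Q A).
Hypotheses (rho01 : 0 <= rho < 1)
  (flip : forall x y, Q x -> Q y -> `|f x - f y| <= rho * `|x - y|).
Variables (alpha lambda : nat -> R) (e : nat -> H) (lmin lmax : R).
Hypotheses (alpha01 : forall n, 0 < alpha n <= 1)
  (lambda02nu : forall n, 0 <= lambda n <= 2 * nu)
  (alpha_cvg0 : alpha @ \oo --> (0 : R))
  (alpha_sum : series alpha @ \oo --> +oo)
  (lmin0 : 0 < lmin) (lambda_min : \forall n \near \oo, lmin <= lambda n)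
  (lmax2 : lmax < 2 * nu) (lambda_max : \forall n \near \oo, lambda n <= lmax)
  (alpha_var : negligible_wrt alpha (fun n => alpha n.+1 - alpha n))
  (lambda_var : negligible_wrt alpha (fun n => lambda n.+1 - lambda n))
  (e_small : negligible_wrt alpha (fun n => `|e n|)).
Variable x : nat -> H.
Let P := metric_projection Q.
Let y n := forward_backward Q A (lambda n) (x n).
Let w n := alpha n *: f (x n) + (1 - alpha n) *: S (y n) + e n.
Hypotheses (x1 : Q (x 1%N)) (xS : forall n, (1 <= n)%N -> x n.+1 = P (w n)).
Variable p : H.
Hypotheses (Qp : Q p) (Sp : S p = p) (pVI : VI_solutions dot A Q p).

Let F := `|f p - p|.

Let rho0 : 0 <= rho. Proof. by case/andP: rho01. Qed.
Let rho1 : 0 < 1 - rho. Proof. by rewrite subr_gt0; case/andP: rho01. Qed.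
Let alpha0 n : 0 < alpha n. Proof. by case/andP: (alpha01 n). Qed.
Let alpha1 n : alpha n <= 1. Proof. by case/andP: (alpha01 n). Qed.
Let rho_alpha n : (1 - rho) * alpha n <= 1.
Proof. have := alpha01 n; have := rho01; nra. Qed.

Let Py z : Q (P z). Proof. exact: projection_in. Qed.

Lemma iterate_in n : (1 <= n)%N -> Q (x n).
Proof. by case: n => [//|[//|n]] _; rewrite xS. Qed.

Let Qy n : Q (y n). Proof. exact: projection_in. Qed.

Lemma inner_step_le n q : (1 <= n)%N -> VI_solutions dot A Q q ->
  `|y n - q| <= `|x n - q|.
Proof.
move=> n1 qVI; have [l0 _] := andP (lambda02nu n).
rewrite -{1}(forward_backward_fixed Hdot clQ cQ Q0 l0 qVI).
apply: (forward_backward_nonexpansive Hdot clQ cQ Q0 Aism) => //.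
  exact: iterate_in.
by case: qVI.
Qed.

Lemma iterate_bounded : exists2 M, 0 <= M &
  forall n, (1 <= n)%N -> `|x n - p| <= M.
Proof.
have [||||||M xM] := @bounded_of_recursion _ alpha (fun n => `|e n|)
  (fun n => `|x n - p|) (1 - rho) F 1%N => //.
- exact: normr_ge0.
- move=> n n1; rewrite xS// -{1}(projection_id Hdot clQ cQ Q0 Qp).
  apply: le_trans (projection_nonexpansive Hdot clQ cQ Q0 _ _) _.
  rewrite (_ : w n - p = alpha n *: (f (x n) - f p) + alpha n *: (f p - p)
      + (1 - alpha n) *: (S (y n) - S p) + e n); last first.
    by rewrite Sp; apply: (dot_ext Hdot) => v; rewrite !(dotE dot); ring.
  have h1 := flip (iterate_in n1) Qp.
  have h2 := le_trans (Sne (Qy n) Qp) (inner_step_le n1 pVI).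
  have h3 := ler_wpM2l (ltW (alpha0 n)) h1.
  have h4 : (1 - alpha n) * `|S (y n) - S p| <= (1 - alpha n) * `|x n - p|.
    by rewrite ler_wpM2l// subr_ge0.
  rewrite (le_trans (ler_normD _ _))// (le_trans (lerD (ler_normD _ _) (lexx _)))//.
  rewrite (le_trans (lerD (lerD (ler_normD _ _) (lexx _)) (lexx _)))//.
  rewrite !normrZ (gtr0_norm (alpha0 n)) (ger0_norm (_ : 0 <= 1 - alpha n)).
    rewrite -/F; lra.
  by rewrite subr_ge0.
exists M => //; exact: le_trans (normr_ge0 _) (xM 1%N (leqnn _)).
Qed.

Lemma anchor_gap_bounded : exists2 G, 0 <= G &
  forall m n, (1 <= m)%N -> (1 <= n)%N -> `|f (x m) - S (y n)| <= G.
Proof.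
have [M M0 xM] := iterate_bounded.
exists (M + F + M) => [|m n m1 n1]; first by rewrite !addr_ge0 ?normr_ge0.
rewrite (_ : _ - _ = (f (x m) - f p) + (f p - p) - (S (y n) - S p)); last first.
  by rewrite Sp; apply: (dot_ext Hdot) => v; rewrite !(dotE dot); ring.
rewrite (le_trans (ler_normB _ _))// lerD//; last first.
  rewrite (le_trans (Sne (Qy n) Qp))// (le_trans (inner_step_le n1 pVI))//.
  exact: xM.
rewrite (le_trans (ler_normD _ _))// lerD2r.
rewrite (le_trans (flip (iterate_in m1) Qp))//.
have := xM m m1; have := normr_ge0 (x m - p); have := rho01; nra.
Qed.

(** The difference of two successive steps is arranged so that [f] and [S] are
    compared with the weights [alpha n] and [1 - alpha n], which contract the
    previous increment; the changes of weight, of step length and of error are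
    the negligible terms. *)
Lemma iterate_increment_cvg0 : `|x n.+1 - x n| @[n --> \oo] --> (0 : R).
Proof.
have [M M0 xM] := iterate_bounded.
have [G G0 fSG] := anchor_gap_bounded.
pose L := `|A p| + M / nu.
have AL n : (1 <= n)%N -> `|A (x n)| <= L.
  move=> n1; rewrite (_ : A (x n) = A p + (A (x n) - A p)); last by rewrite subrKC.
  rewrite (le_trans (ler_normD _ _))// lerD2l ler_pdivlMr// mulrC.
  by rewrite (le_trans (ism_lipschitz Hdot Aism (iterate_in n1) Qp))// xM.
pose b n := (G * `|alpha n.+1 - alpha n| + L * `|lambda n.+1 - lambda n|)
            + (`|e n.+1| + `|e n|).
have b_small : negligible_wrt alpha b.
  apply: negligible_wrtD; apply: negligible_wrtD.
  - by apply: negligible_wrtZ; exact: negligible_wrt_norm.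
  - by apply: negligible_wrtZ; exact: negligible_wrt_norm.
  - exact: (negligible_wrt_shift (b := fun n => `|e n|)).
  - exact: e_small.
apply: (@cvg0_of_recursion _ alpha b _ (fun=> 0) (1 - rho)) => //.
  by move=> eps eps0; apply: nearW => n; exact: ltW.
exists 1%N => // n /= n1; rewrite mulr0 addr0.
have n2 : (1 <= n.+1)%N by [].
rewrite (xS n1) (xS n2).
apply: le_trans (projection_nonexpansive Hdot clQ cQ Q0 _ _) _.
rewrite (_ : _ - _ = alpha n *: (f (x n.+1) - f (x n))
    + (alpha n.+1 - alpha n) *: (f (x n.+1) - S (y n.+1))
    + (1 - alpha n) *: (S (y n.+1) - S (y n)) + (e n.+1 - e n)); last first.
  by apply: (dot_ext Hdot) => v; rewrite !(dotE dot); ring.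
rewrite (le_trans (ler_normD _ _))// (le_trans (lerD (ler_normD _ _) (lexx _)))//.
rewrite (le_trans (lerD (lerD (ler_normD _ _) (lexx _)) (lexx _)))// !normrZ.
rewrite (gtr0_norm (alpha0 n)) (ger0_norm (_ : 0 <= 1 - alpha n)) ?subr_ge0//.
have h1 := ler_wpM2l (ltW (alpha0 n)) (flip (iterate_in n2) (iterate_in n1)).
have h2 := ler_wpM2l (normr_ge0 (alpha n.+1 - alpha n)) (fSG _ _ n2 n2).
have h3 : `|S (y n.+1) - S (y n)|
    <= `|x n.+1 - x n| + `|lambda n.+1 - lambda n| * L.
  rewrite (le_trans (Sne (Qy _) (Qy _)))//.
  rewrite -(subrKA (forward_backward Q A (lambda n.+1) (x n))).
  rewrite (le_trans (ler_normD _ _))// lerD//.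
    apply: (forward_backward_nonexpansive Hdot clQ cQ Q0 Aism) => //;
    exact: iterate_in.
  rewrite (le_trans (forward_backward_step Hdot _ clQ cQ Q0 _ _ _))//.
  by rewrite ler_wpM2l// AL.
have h4 : (1 - alpha n) * `|S (y n.+1) - S (y n)|
    <= (1 - alpha n) * `|x n.+1 - x n| + `|lambda n.+1 - lambda n| * L.
  have a0 : 0 <= 1 - alpha n by rewrite subr_ge0.
  rewrite (le_trans (ler_wpM2l a0 h3))// mulrDr lerD2l.
  have L0 : 0 <= L by exact: le_trans (normr_ge0 _) (AL 1%N _).
  by apply: ler_piMl; [exact: mulr_ge0|rewrite gerBl ltW].
have h5 := ler_normB (e n.+1) (e n).
rewrite /b -(xS n1); lra.
Qed.

Lemma iterate_outer_gap_cvg0 : `|x n - S (y n)| @[n --> \oo] --> (0 : R).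
Proof.
have [G G0 fSG] := anchor_gap_bounded.
apply: (@squeeze_cvgr _ _ _ _ (fun=> 0)
  (fun n => `|x n.+1 - x n| + (alpha n * G + `|e n|))).
- exists 1%N => // n /= n1; rewrite normr_ge0/=.
  rewrite -(subrKA (x n.+1)) (le_trans (ler_normD _ _))// distrC lerD2l.
  rewrite xS// -{1}(projection_id Hdot clQ cQ Q0 (SQ (Qy n))).
  apply: le_trans (projection_nonexpansive Hdot clQ cQ Q0 _ _) _.
  rewrite (_ : _ - _ = alpha n *: (f (x n) - S (y n)) + e n); last first.
    by apply: (dot_ext Hdot) => v; rewrite !(dotE dot); ring.
  rewrite (le_trans (ler_normD _ _))// lerD2r normrZ (gtr0_norm (alpha0 n)).
  by rewrite ler_wpM2l ?fSG// ltW.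
- exact: cvg_cst.
- rewrite -[X in _ --> X](addr0 0); apply: cvgD.
    exact: iterate_increment_cvg0.
  rewrite -[X in _ --> X](addr0 0); apply: cvgD.
    by rewrite -[X in _ --> X](mul0r G); apply: cvgM => //; exact: cvg_cst.
  exact: negligible_wrt_cvg0 alpha01 e_small.
Qed.

(** Up to the outer gap, [S] being nonexpansive at [p], the map [J (lambda n)]
    brings [x n] no nearer to [p]; the two extra terms of [forward_backward_gap]
    then vanish.  This is where [lambda] has to stay away from 0 and [2 * nu]. *)
Lemma iterate_inner_gap_cvg0 : `|x n - y n| @[n --> \oo] --> (0 : R).
Proof.
have [M M0 xM] := iterate_bounded.
pose r n := `|x n - S (y n)|; pose c := lmin * (2 * nu - lmax).
have c0 : 0 < c by rewrite mulr_gt0// subr_gt0.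
pose K := 2 * (1 + (2 * nu) ^+ 2 / c).
apply: cvg0_of_sqr.
apply: (@squeeze_cvgr _ _ _ _ (fun=> 0) (fun n => K * (r n * r n + 2 * M * r n))).
- near=> n; rewrite sqr_ge0/=.
  have n1 : (1 <= n)%N by near: n; exact: nbhs_infty_ge.
  have lm : lmin <= lambda n by near: n.
  have lM : lambda n <= lmax by near: n.
  have [l0 l2] := andP (lambda02nu n).
  have := forward_backward_gap Hdot clQ cQ Q0 Aism l0 (iterate_in n1) pVI.
  rewrite -/(y n); set D := A _ - A p; set V := _ - _ *: D => gap.
  have xr : `|x n - p| <= r n + `|y n - p|.
    rewrite -(subrKA (S (y n))) (le_trans (ler_normD _ _))// lerD2l.
    by rewrite -{1}Sp Sne.
  have xr2 : `|x n - p| ^+ 2 <= (r n + `|y n - p|) ^+ 2.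
    by rewrite ler_pXn2r ?nnegrE ?addr_ge0 ?normr_ge0//.
  have yM : `|y n - p| <= M.
    by rewrite (le_trans (inner_step_le n1 pVI))// xM.
  have ryM : r n * `|y n - p| <= r n * M by rewrite ler_wpM2l ?normr_ge0.
  have cl : c <= lambda n * (2 * nu - lambda n).
    by rewrite /c ler_pM ?subr_ge0 ?lerB// ltW.
  have clD := ler_wpM2r (sqr_ge0 `|D|) cl.
  have V0 := sqr_ge0 `|V|; have D0 := sqr_ge0 `|D|.
  set B := r n * r n + 2 * M * r n.
  have VB : `|V| ^+ 2 + c * `|D| ^+ 2 <= B.
    rewrite /B; move: gap xr2 ryM clD; move: (r n) `|y n - p| => rn yn.
    by move: (c * _) (_ * `|D| ^+ 2) (`|V| ^+ 2) => a b v; lra.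
  have DB : `|D| ^+ 2 <= B / c by rewrite ler_pdivlMr// mulrC; lra.
  have VB' : `|V| ^+ 2 <= B by have := mulr_ge0 (ltW c0) D0; lra.
  have lD : (lambda n * `|D|) ^+ 2 <= (2 * nu) ^+ 2 * (B / c).
    rewrite exprMn ler_pM ?sqr_ge0// ler_pXn2r ?nnegrE//; lra.
  have xV : `|x n - y n| <= `|V| + lambda n * `|D|.
    rewrite -(ger0_norm l0) -normrZ -[x n - y n](subrK (lambda n *: D)).
    exact: ler_normD.
  have : `|x n - y n| ^+ 2 <= (`|V| + lambda n * `|D|) ^+ 2.
    by rewrite ler_pXn2r ?nnegrE ?addr_ge0 ?mulr_ge0 ?normr_ge0//.
  have := sqr_ge0 (`|V| - lambda n * `|D|).
  have -> : K * B = 2 * B + 2 * ((2 * nu) ^+ 2 * (B / c)) by rewrite /K; ring.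
  lra.
- exact: cvg_cst.
- have r0 : r @ \oo --> (0 : R) by exact: iterate_outer_gap_cvg0.
  have -> : (0 : R) = K * (0 * 0 + 2 * M * 0) by rewrite !mulr0 addr0 mulr0.
  by apply: cvgM; [exact: cvg_cst|apply: cvgD; apply: cvgM => //; exact: cvg_cst].
Unshelve. all: by end_near. Qed.

Lemma iterate_residual_cvg0 :
  `|x n - S (forward_backward Q A nu (x n))| @[n --> \oo] --> (0 : R).
Proof.
apply: (@squeeze_cvgr _ _ _ _ (fun=> 0)
  (fun n => `|x n - S (y n)| + (nu / lmin) * `|x n - y n|)).
- near=> n; rewrite normr_ge0/=.
  have lm : lmin <= lambda n by near: n.
  have [l0 l2] := andP (lambda02nu n).
  have QJ := forward_backward_in Hdot A clQ cQ Q0 nu (x n).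
  rewrite -(subrKA (S (y n))) (le_trans (ler_normD _ _))// lerD2l.
  rewrite (le_trans (Sne (Qy n) QJ))// distrC mulrAC ler_pdivlMr// mulrC.
  have := forward_backward_residual Hdot A clQ cQ Q0 (x n) l0 (ltW nu0).
  rewrite -/(y n) => h; have h1 : `|nu - lambda n| <= nu.
    rewrite ler_norml; lra.
  have := ler_wpM2r (normr_ge0 (x n - y n)) h1.
  have := ler_wpM2r (normr_ge0 (forward_backward Q A nu (x n) - y n)) lm.
  lra.
- exact: cvg_cst.
- rewrite -[X in _ --> X](addr0 0); apply: cvgD.
    exact: iterate_outer_gap_cvg0.
  rewrite -[X in _ --> X](mulr0 (nu / lmin)); apply: cvgM; first exact: cvg_cst.
  exact: iterate_inner_gap_cvg0.
Unshelve. all: by end_near. Qed.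

(** The projection being firm, [|x n.+1 - q|^2] is at most the product of [w n - q]
    with [x n.+1 - q], which is split along the definition of [w n]; the term in
    [f q - q] is controlled by the anchor property of [q]. *)
Lemma iterate_cvg q : Q q -> S q = q -> VI_solutions dot A Q q ->
  (forall M eps : R, 0 < eps -> exists2 dl : R, 0 < dl &
      forall z, Q z -> `|z - q| <= M ->
        `|z - S (forward_backward Q A nu z)| <= dl ->
        dot (f q - q) (z - q) <= eps) ->
  x @ \oo --> q.
Proof.
move=> Qq Sq qVI q_anchor.
have [M0 _ xM0] := iterate_bounded.
pose M := M0 + `|p - q|.
have xM n : (1 <= n)%N -> `|x n - q| <= M.
  move=> n1; rewrite -(subrKA p) (le_trans (ler_normD _ _))// lerD2r.
  exact: xM0.
apply/subr_cvg0/norm_cvg0P; apply: cvg0_of_sqr.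
pose b n := 2 * M * `|e n|.
apply: (@cvg0_of_recursion _ alpha b _
  (fun n => 2 * dot (f q - q) (x n.+1 - q)) (1 - rho)) => //.
- exact: negligible_wrtZ.
- move=> eps eps0; have e2 : 0 < eps / 2 by rewrite divr_gt0.
  have [dl dl0 dlP] := q_anchor M _ e2.
  have /cvgr0Pnorm_le/(_ _ dl0) := iterate_residual_cvg0.
  move=> [N _ NP]; exists N => // n /= Nn.
  rewrite mulrC -ler_pdivlMr//; apply: dlP; [exact: iterate_in|exact: xM|].
  by have := NP n.+1 (leqW Nn); rewrite /= normr_id.
exists 1%N => // n /= n1.
have := projection_firm Hdot clQ cQ Q0 (w n) q.
rewrite (projection_id Hdot clQ cQ Q0 Qq) -/P -(xS n1).
rewrite (_ : w n - q = alpha n *: (f (x n) - f q) + alpha n *: (f q - q)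
    + (1 - alpha n) *: (S (y n) - S q) + e n); last first.
  by rewrite Sq; apply: (dot_ext Hdot) => v; rewrite !(dotE dot); ring.
have xM' : `|x n.+1 - q| <= M by exact: xM.
set d := x n.+1 - q in xM' *; set s := x n - q.
rewrite 3!(dotDl dot) !(dotZl dot) => firm.
have h1 : dot (f (x n) - f q) d <= rho * (`|s| * `|d|).
  rewrite (le_trans (cauchy_schwarz Hdot _ _))// mulrA ler_wpM2r//.
  by rewrite flip//; exact: iterate_in.
have h2 : dot (S (y n) - S q) d <= `|s| * `|d|.
  rewrite (le_trans (cauchy_schwarz Hdot _ _))// ler_wpM2r//.
  by rewrite (le_trans (Sne (Qy n) Qq))// inner_step_le.
have h3 : dot (e n) d <= M * `|e n|.
  rewrite (le_trans (cauchy_schwarz Hdot _ _))// mulrC ler_wpM2r//.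
have h4 := ler_wpM2l (ltW (alpha0 n)) h1.
have h5 : (1 - alpha n) * dot (S (y n) - S q) d <= (1 - alpha n) * (`|s| * `|d|).
  by rewrite ler_wpM2l// subr_ge0.
have sd : 2 * (`|s| * `|d|) <= `|s| ^+ 2 + `|d| ^+ 2.
  by have := sqr_ge0 (`|s| - `|d|); lra.
have g0 : 0 <= 1 - (1 - rho) * alpha n by rewrite subr_ge0.
have h6 := ler_wpM2l g0 sd.
have h7 : 0 <= (1 - rho) * alpha n * `|d| ^+ 2.
  by rewrite mulr_ge0 ?sqr_ge0// mulr_ge0// ltW.
move: firm h3 h4 h5 h6 h7; rewrite /b.
move: (dot _ d) (dot _ d) (dot _ d) (dot _ d) => a1 a2 a3 a4.
lra.
Qed.

End Iteration.

Theorem theorem4p2 (R : realType) (H : completeNormedModType R)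
    (dot : {dot H for idfun}) (Hdot : norm_associated dot)
    (Q : set H) (Q0 : Q !=set0) (Qclosed : closed Q) (Qconvex : convex_set Q)
    (S : {fun Q >-> Q}) (Snonexp : 1.-lipschitz_Q S)
    (nu : R) (nu0 : 0 < nu)
    (A : H -> H) (Aism : inverse_strongly_monotone dot nu Q A)
    (rho : {nonneg R}) (f : {fun Q >-> Q}) (fcontr : contraction rho f)
    (Omega := fixed_points Q S `&` VI_solutions dot A Q)
    (Omega0 : Omega !=set0)
    (alpha lambda : nat -> R) (e : nat -> H)
    (alpha01 : forall n, 0 < alpha n <= 1)
    (lambda02nu : forall n, 0 <= lambda n <= 2 * nu)
    (alpha_cvg0 : alpha @ \oo --> (0 : R))
    (alpha_sum : series alpha @ \oo --> +oo)
    (lambda_lim : [/\ 0 < limn_inf lambda,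
                      limn_inf lambda <= limn_sup lambda
                    & limn_sup lambda < 2 * nu])
    (alpha_var :
      ((alpha n.+1 - alpha n) / alpha n @[n --> \oo] --> (0 : R)) \/
      cvgn [series `|alpha n.+1 - alpha n|]_n)
    (lambda_var :
      ((lambda n.+1 - lambda n) / alpha n @[n --> \oo] --> (0 : R)) \/
      cvgn [series `|lambda n.+1 - lambda n|]_n)
    (e_small :
      (`|e n| / alpha n @[n --> \oo] --> (0 : R)) \/ cvgn [series `|e n|]_n)
    (P := metric_projection Q) :
  exists qstar : H,
    [/\ VP_solutions dot f Omega qstar,
        forall q : H, VP_solutions dot f Omega q -> q = qstar
      & forall x : nat -> H,
          Q (x 1%N) ->
          (forall n : nat, (1 <= n)%N ->
             x n.+1 = P (alpha n *: f (x n)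
                         + (1 - alpha n) *: S (P (x n - lambda n *: A (x n)))
                         + e n)) ->
          x @ \oo --> qstar].

Proof.
have SQ z : Q z -> Q (S z) by exact: funS.
have fQ z : Q z -> Q (f z) by exact: funS.
have Sne z1 z2 : Q z1 -> Q z2 -> `|S z1 - S z2| <= `|z1 - z2|.
  by move=> Qz1 Qz2; have := Snonexp (z1, z2); rewrite /= mul1r; exact.
have [rho1 flip0] := fcontr.
have flip z1 z2 : Q z1 -> Q z2 -> `|f z1 - f z2| <= rho%:num * `|z1 - z2|.
  by move=> Qz1 Qz2; have := flip0 (z1, z2); exact.
have rho01 : 0 <= rho%:num < 1 by rewrite rho1 andbT.
have nu02 : 0 < nu < 2 * nu by rewrite nu0 mulrC mulr_natr mulr2n ltrDl.
have fixT := fixed_points_forward_backward Hdot Qclosed Qconvex Q0 Aism nu02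
  SQ Sne Omega0.
have TQ z : Q z -> Q ((S \o forward_backward Q A nu) z).
  by move=> Qz; apply: SQ; exact: forward_backward_in.
have nu_le : 0 <= nu <= 2 * nu by case/andP: nu02 => /ltW-> /ltW->.
have Tne z1 z2 : Q z1 -> Q z2 ->
    `|(S \o forward_backward Q A nu) z1 - (S \o forward_backward Q A nu) z2|
      <= `|z1 - z2|.
  move=> Qz1 Qz2; apply: le_trans (Sne _ _ _ _) _; try exact: forward_backward_in.
  exact: (forward_backward_nonexpansive Hdot Qclosed Qconvex Q0 Aism).
have Tfix : fixed_points Q (S \o forward_backward Q A nu) !=set0 by rewrite fixT.
have [q [qfix q_anchor]] := viscosity_point Hdot Qclosed Qconvex TQ Tne Tfix
  rho01 fQ flip.
have qO : Omega q by rewrite /Omega -fixT.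
have qVP : VP_solutions dot f Omega q.
  split=> // z Oz; have : fixed_points Q (S \o forward_backward Q A nu) z.
    by rewrite fixT.
  move=> [Qz Tz]; apply/ler_addgt0Pl => eps eps0; rewrite addr0.
  have [dl dl0] := q_anchor `|z - q| _ eps0; apply => //.
  by rewrite Tz subrr normr0 ltW.
exists q; split=> // [q' q'VP|x Qx xS].
  by apply: (VP_solution_unique Hdot rho1 flip) q'VP qVP; move=> z [] [].
have alpha0 n : 0 < alpha n by case/andP: (alpha01 n).
have lambda_bnd : bounded_fun lambda.
  exists (2 * nu); split; first exact: num_real.
  move=> M nuM n _ /=; rewrite ger0_norm; last by case/andP: (lambda02nu n).
  by rewrite (le_trans _ (ltW nuM))//; case/andP: (lambda02nu n).
have [linf0 _ lsup2] := lambda_lim.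
have [lmin lmin0 lambda_min] := limn_inf_gt0 lambda_bnd linf0.
have [lmax lmax2 lambda_max] := limn_sup_lt lambda_bnd lsup2.
have e_negl : negligible_wrt alpha (fun n => `|e n|).
  apply: negligible_ratio_or_summable => //; case: e_small; first by left.
  by right; under eq_fun do rewrite normr_id.
have [[Qq Sq] qVI] := qO.
exact: (iterate_cvg Hdot Qclosed Qconvex Q0 SQ Sne nu0 Aism rho01 flip alpha01
  lambda02nu alpha_cvg0 alpha_sum lmin0 lambda_min lmax2 lambda_max
  (negligible_ratio_or_summable alpha0 alpha_var)
  (negligible_ratio_or_summable alpha0 lambda_var) e_negl Qx xS Qq Sq qVI Qq Sq qVI
  q_anchor).
Qed.
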